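(* Suppose $\mathcal{Y}=\mathbb{R}^n$, and each $f_i$ is strongly convex with constant $\mu_i>0$ and differentiable with $\nabla f_i$ Lipschitz continuous on $\mathbb{R}^n$ with constant $L_i>0$, $i=1,\dots,m$. Let $\mu=\min_i\mu_i$, $L=\max_iL_i$, $L_h=(1/\mu)(2+2\cos(\pi/m))$, $\mu_h=(1/L)(2-2\cos(\pi/m))$, $h=-g$, and let $\boldsymbol{\lambda}^\star$ be a dual optimal solution, i.e. a maximizer of $g$. Let $\{\boldsymbol{\lambda}^{(k)}\}_{k\ge0}$ be generated by the inexact dual algorithm with distortions satisfying $\|\mathbf{r}_i^{(k)}\|\le\varepsilon_i$ for all $i,k$ and with stepsizes satisfying $0<\gamma_k\le1/L_h$ for all $k\ge0$. Then for every $k\ge0$, $$h(\boldsymbol{\lambda}^{(k+1)})-h(\boldsymbol{\lambda}^\star)\le(1-\gamma_k\mu_h)\left(h(\boldsymbol{\lambda}^{(k)})-h(\boldsymbol{\lambda}^\star)\right)+\frac{\gamma_k\epsilon^2}{2}.$$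
   Context: Let $m\ge2$, $n\ge1$ be integers, $\mathcal{Y}\subseteq\mathbb{R}^n$ a closed convex set, and $f_i:\mathbb{R}^n\to\mathbb{R}$, $i=1,\dots,m$, strictly convex closed functions. For $\mathbf{y}=(\mathbf{y}_1,\dots,\mathbf{y}_m)\in(\mathbb{R}^n)^m=\mathbb{R}^{nm}$ put $f(\mathbf{y})=\sum_{i=1}^m f_i(\mathbf{y}_i)$, let $\bar{\mathcal{Y}}=\mathcal{Y}^m$, and $\mathbf{A}\mathbf{y}=(\mathbf{y}_1-\mathbf{y}_2,\dots,\mathbf{y}_{m-1}-\mathbf{y}_m)\in\mathbb{R}^{n(m-1)}$. The dual function is $g(\boldsymbol{\lambda})=\inf_{\mathbf{y}\in\bar{\mathcal{Y}}}\big[f(\mathbf{y})+\boldsymbol{\lambda}^{T}\mathbf{A}\mathbf{y}\big]$, $\boldsymbol{\lambda}\in\mathbb{R}^{n(m-1)}$. Inexact dual algorithm: start from any $\boldsymbol{\lambda}^{(0)}\in\mathbb{R}^{n(m-1)}$; for $k=0,1,2,\dots$ let $\mathbf{y}^{(k)}=\arg\min_{\mathbf{y}\in\bar{\mathcal{Y}}}\big[f(\mathbf{y})+(\boldsymbol{\lambda}^{(k)})^{T}\mathbf{A}\mathbf{y}\big]$, let $\hat{\mathbf{y}}_i^{(k)}=\mathbf{y}_i^{(k)}+\mathbf{r}_i^{(k)}$ where $\mathbf{r}_i^{(k)}\in\mathbb{R}^n$ are arbitrary distortions, let $\hat{\mathbf{d}}^{(k)}=\mathbf{A}\hat{\mathbf{y}}^{(k)}$,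 and set $\boldsymbol{\lambda}^{(k+1)}=\boldsymbol{\lambda}^{(k)}+\gamma_k\hat{\mathbf{d}}^{(k)}$. The distortions are bounded by constants: $\|\mathbf{r}_i^{(k)}\|\le\varepsilon_i$ for all $i$ and $k$, and $\epsilon:=\sqrt{\sum_{i=1}^{m-1}(\varepsilon_i+\varepsilon_{i+1})^2}$. Norms are Euclidean. A function $\varphi$ is strongly convex with constant $\sigma>0$ if $\varphi-\frac{\sigma}{2}\|\cdot\|^2$ is convex. *)

(* Defs.v *)
From mathcomp Require Export all_boot all_order all_algebra.
From mathcomp Require Export all_classical all_reals all_analysis.
Export Order.TTheory GRing.Theory Num.Theory.
Export numFieldNormedType.Exports.

Set Implicit Arguments.
Unset Strict Implicit.
Unset Printing Implicit Defensive.

Local Open Scope classical_set_scope.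
Local Open Scope ring_scope.

(* A vector of (R^n)^m is a matrix in 'M_(m, n) whose i-th row is its i-th
   block. The norm of the library on matrices is the sup norm; the Euclidean
   inner product and norm are therefore introduced separately. *)
Definition dot (R : realType) (m n : nat) (u v : 'M[R]_(m, n)) : R :=
  \sum_(i < m) \sum_(j < n) u i j * v i j.

Definition enorm (R : realType) (m n : nat) (u : 'M[R]_(m, n)) : R :=
  Num.sqrt (dot u u).

Definition grad (R : realType) (n : nat) (phi : 'rV[R]_n -> R) (x : 'rV[R]_n) :
    'rV[R]_n :=
  \row_(j < n) 'D_(delta_mx 0 j) (phi : 'rV[R]_n -> R^o) x.

Definition strongly_convex (R : realType) (n : nat) (sigma : R)
    (phi : 'rV[R]_n -> R) : Prop :=
  convex_function [set: convex_lmodType 'rV[R]_n]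
    (fun x : 'rV[R]_n => phi x - sigma / 2 * enorm x ^+ 2).

Definition lipschitz_grad (R : realType) (n : nat) (L : R)
    (phi : 'rV[R]_n -> R) : Prop :=
  forall x y : 'rV[R]_n,
    enorm (grad phi x - grad phi y) <= L * enorm (x - y).

Definition is_argmin (R : realType) (T : Type) (D : set T) (F : T -> R)
    (x : T) : Prop :=
  D x /\ forall z, D z -> F x <= F z.

(* Below there are m.+1 blocks, hence m coupling constraints
   y_l = y_(l+1); for l : 'I_m, the blocks l and l+1 are the images of l by
   widen_ord and lift ord0. *)
Definition prod_set (R : realType) (m n : nat) (Y : set 'rV[R]_n) :
    set 'M[R]_(m.+1, n) :=
  [set y | forall i, Y (row i y)].

Definition diffA (R : realType) (m n : nat) (y : 'M[R]_(m.+1, n)) :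
    'M[R]_(m, n) :=
  \matrix_(l < m, j < n) (y (widen_ord (leqnSn m) l) j - y (lift ord0 l) j).

Definition lagrangian (R : realType) (m n : nat)
    (f : 'I_m.+1 -> 'rV[R]_n -> R) (lam : 'M[R]_(m, n))
    (y : 'M[R]_(m.+1, n)) : R :=
  \sum_(i < m.+1) f i (row i y) + dot lam (diffA y).

Definition dual_fun (R : realType) (m n : nat) (Y : set 'rV[R]_n)
    (f : 'I_m.+1 -> 'rV[R]_n -> R) (lam : 'M[R]_(m, n)) : \bar R :=
  ereal_inf [set (lagrangian f lam y)%:E | y in prod_set Y].

Definition dual_optimal (R : realType) (m n : nat) (Y : set 'rV[R]_n)
    (f : 'I_m.+1 -> 'rV[R]_n -> R) (lam : 'M[R]_(m, n)) : Prop :=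
  forall lam', (dual_fun Y f lam' <= dual_fun Y f lam)%E.

Definition inexact_dual_algorithm (R : realType) (m n : nat)
    (Y : set 'rV[R]_n) (f : 'I_m.+1 -> 'rV[R]_n -> R) (gamma : nat -> R)
    (lam : nat -> 'M[R]_(m, n)) (y r : nat -> 'M[R]_(m.+1, n)) : Prop :=
  forall k : nat,
    is_argmin (prod_set Y) (lagrangian f (lam k)) (y k) /\
    lam k.+1 = lam k + gamma k *: diffA (y k + r k).

Definition total_distortion (R : realType) (m : nat) (eps : 'I_m.+1 -> R) : R :=
  Num.sqrt (\sum_(l < m)
    (eps (widen_ord (leqnSn m) l) + eps (lift ord0 l)) ^+ 2).

Definition minf (R : realType) (m : nat) (a : 'I_m.+1 -> R) : R :=
  \big[Num.min/a ord0]_(i < m.+1) a i.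

Definition maxf (R : realType) (m : nat) (a : 'I_m.+1 -> R) : R :=
  \big[Num.max/a ord0]_(i < m.+1) a i.

(* Main.v *)
(** Write [A] for [diffA]. Since the objective is [minf mu]-strongly convex with
    a [maxf L]-Lipschitz gradient, along a step [d] the function [h] lies below
    its quadratic model with curvature [|A^T d|^2 / minf mu] and above the one
    with curvature [|A^T d|^2 / maxf L]. The matrix [A A^T] is the
    second-difference matrix of a path, with extreme eigenvalues
    [2 - 2 cos (pi / (m + 2))] and [2 + 2 cos (pi / (m + 2))] for [m + 2] agents,
    which turns the two curvatures into [Lh |d|^2] and [muh |d|^2]. As
    [gamma Lh <= 1], the upper model at the step [gamma (a + e)], where [a = A y]
    and [e = A r], gives a decrease of at least [gamma (|a|^2 - |e|^2) / 2]; the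
    lower model bounds [|a|^2 / 2] below by [muh] times the optimality gap. *)

Require Import Defs.
From mathcomp Require Import ring lra.

Set Implicit Arguments.
Unset Strict Implicit.
Unset Printing Implicit Defensive.

Local Open Scope classical_set_scope.
Local Open Scope ring_scope.

Section Dot.
Variable R : realType.
Implicit Types m n : nat.

Lemma dotC m n (u v : 'M[R]_(m, n)) : dot u v = dot v u.
Proof. by apply: eq_bigr => i _; apply: eq_bigr => j _; rewrite mulrC. Qed.

Lemma dotDr m n (u v w : 'M[R]_(m, n)) : dot u (v + w) = dot u v + dot u w.
Proof.
rewrite /dot -big_split; apply: eq_bigr => i _; rewrite -big_split.
by apply: eq_bigr => j _; rewrite mxE mulrDr.
Qed.

Lemma dotZr m n a (u v : 'M[R]_(m, n)) : dot u (a *: v) = a * dot u v.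
Proof.
rewrite /dot mulr_sumr; apply: eq_bigr => i _; rewrite mulr_sumr.
by apply: eq_bigr => j _; rewrite mxE mulrCA.
Qed.

Lemma dotNr m n (u v : 'M[R]_(m, n)) : dot u (- v) = - dot u v.
Proof. by rewrite -scaleN1r dotZr mulN1r. Qed.

Lemma dotDl m n (u v w : 'M[R]_(m, n)) : dot (u + v) w = dot u w + dot v w.
Proof. by rewrite dotC dotDr !(dotC w). Qed.

Lemma dotZl m n a (u v : 'M[R]_(m, n)) : dot (a *: u) v = a * dot u v.
Proof. by rewrite dotC dotZr dotC. Qed.

Lemma dotNl m n (u v : 'M[R]_(m, n)) : dot (- u) v = - dot u v.
Proof. by rewrite dotC dotNr dotC. Qed.

Definition dotE := (dotDl, dotDr, dotNl, dotNr, dotZl, dotZr).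

Lemma dot_ge0 m n (u : 'M[R]_(m, n)) : 0 <= dot u u.
Proof.
by apply: sumr_ge0 => i _; apply: sumr_ge0 => j _; rewrite -expr2 sqr_ge0.
Qed.

Lemma dot_eq0 m n (u : 'M[R]_(m, n)) : dot u u <= 0 -> u = 0.
Proof.
move=> u_le0; have /eqP : dot u u = 0 by apply/eqP; rewrite eq_le u_le0 dot_ge0.
rewrite psumr_eq0 => [/allP row0|i _]; last first.
  by apply: sumr_ge0 => j _; rewrite -expr2 sqr_ge0.
apply/matrixP => i j; have := row0 i (mem_index_enum i); rewrite implyTb.
rewrite psumr_eq0 => [/allP/(_ j (mem_index_enum j))|? _].
  by rewrite implyTb -expr2 sqrf_eq0 mxE => /eqP.
by rewrite -expr2 sqr_ge0.
Qed.

Lemma enorm_ge0 m n (u : 'M[R]_(m, n)) : 0 <= enorm u.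
Proof. exact: sqrtr_ge0. Qed.

Lemma sqr_enorm m n (u : 'M[R]_(m, n)) : enorm u ^+ 2 = dot u u.
Proof. by rewrite sqr_sqrtr// dot_ge0. Qed.

Lemma dot_le_enorm m n (u v : 'M[R]_(m, n)) : dot u v <= enorm u * enorm v.
Proof.
have [v_eq0|v_neq0] := eqVneq (dot v v) 0.
  rewrite (dot_eq0 (u := v)) ?v_eq0//.
  by rewrite -(scale0r 0) dotZr mul0r mulr_ge0 ?enorm_ge0.
have v_gt0 : 0 < dot v v by rewrite lt_neqAle eq_sym v_neq0 dot_ge0.
have := dot_ge0 (dot v v *: u - dot u v *: v).
rewrite !dotE (dotC v u) => H.
have {}H : dot u v ^+ 2 <= dot u u * dot v v.
  by rewrite -subr_ge0 -(pmulr_rge0 _ v_gt0); lra.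
apply: le_trans (ler_norm _) _.
rewrite -(@ler_pXn2r _ 2)// ?nnegrE ?mulr_ge0 ?enorm_ge0//.
by rewrite real_normK ?num_real// exprMn !sqr_enorm.
Qed.

Lemma ler_enormB m n (u v : 'M[R]_(m, n)) : enorm (u - v) <= enorm u + enorm v.
Proof.
rewrite -(@ler_pXn2r _ 2)// ?nnegrE ?addr_ge0 ?enorm_ge0//.
have := dot_le_enorm u (- v).
have -> : enorm (- v) = enorm v by rewrite /enorm !dotE opprK.
rewrite sqrrD !sqr_enorm !dotE (dotC v u) mulr2n; lra.
Qed.

Lemma dot_row m n (u v : 'M[R]_(m, n)) :
  dot u v = \sum_i dot (row i u) (row i v).
Proof.
apply: eq_bigr => i _; rewrite /dot big_ord1.
by apply: eq_bigr => j _; rewrite !mxE.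
Qed.

End Dot.

Section DescentLemma.
Variables (R : realType) (n : nat).
Implicit Types (phi : 'rV[R]_n.+1 -> R) (x w : 'rV[R]_n.+1).

Lemma derive_grad phi x w : differentiable (phi : _ -> R^o) x ->
  'D_w (phi : _ -> R^o) x = dot (grad phi x) w.
Proof.
move=> dphi; rewrite deriveE// {1}[w]row_sum_delta linear_sum /dot big_ord1.
by apply: eq_bigr => j _; rewrite linearZ mxE deriveE//= mulrC.
Qed.

Lemma is_derive_line phi x w (t : R) :
  (forall z, differentiable (phi : _ -> R^o) z) ->
  is_derive t 1 (fun s => phi (x + s *: w)) (dot (grad phi (x + t *: w)) w).
Proof.
move=> dphi; rewrite -derive_grad//.
have E : (fun h : R => h^-1 *: (((fun s => phi (x + s *: w) : R^o) \o shift t)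
     (h *: (1 : R)) - phi (x + t *: w))) =
  (fun h : R => h^-1 *: (((phi : _ -> R^o) \o shift (x + t *: w)) (h *: w)
     - phi (x + t *: w))).
  apply/funext => h /=; congr (_ *: (phi _ - _)).
  by rewrite scalerDl addrCA; congr (_ *: _ + _); rewrite /GRing.scale/= mulr1.
by split; [rewrite /derivable E; exact: diff_derivable|rewrite /derive E].
Qed.

Lemma descent_lemma phi (L : R) x w :
  (forall z, differentiable (phi : _ -> R^o) z) -> lipschitz_grad L phi ->
  phi (x + w) <= phi x + dot (grad phi x) w + L / 2 * dot w w.
Proof.
move=> dphi lip.
pose g := fun t : R => phi (x + t *: w) - t * dot (grad phi x) w
  - L / 2 * dot w w * t ^+ 2.
pose dg := fun t : R => dot (grad phi (x + t *: w) - grad phi x) w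
  - L * dot w w * t.
have isdg (t : R) : is_derive t 1 g (dg t).
  have := is_derive_line x w t dphi => D.
  apply: is_derive_eq; rewrite /dg !dotE /GRing.scale/=.
  by field.
have [|c c01] := MVT (a := 0) (b := 1) ltr01 (fun t _ => isdg t).
  by apply: derivable_within_continuous => t _; exact: ex_derive.
rewrite subr0 mulr1 => gE.
have dg_le0 : dg c <= 0.
  rewrite /dg subr_le0; apply: le_trans (dot_le_enorm _ _) _.
  have /ltW c_ge0 : 0 < c by rewrite (itvP c01).
  rewrite -sqr_enorm expr2 mulrAC mulrA ler_wpM2r ?enorm_ge0//.
  apply: le_trans (lip _ _) _; rewrite -mulrA [x + _]addrC addrK.
  have -> : enorm (c *: w) = c * enorm w; last exact: lexx.
  by rewrite /enorm !dotE mulrA -expr2 sqrtrM ?sqr_ge0// sqrtr_sqr ger0_norm.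
move: dg_le0; rewrite -gE /g scale1r scale0r addr0; lra.
Qed.

End DescentLemma.

Section Adjoint.
Variables (R : realType) (m n : nat).
Implicit Types (d : 'M[R]_(m, n)) (y : 'M[R]_(m.+1, n)).

Definition append0 d : 'M[R]_(m.+1, n) :=
  \matrix_(i, j) if unlift ord_max i is Some l then d l j else 0.

Definition prepend0 d : 'M[R]_(m.+1, n) :=
  \matrix_(i, j) if unlift ord0 i is Some l then d l j else 0.

Definition adjA d := append0 d - prepend0 d.

Lemma widen_lift_max (l : 'I_m) : widen_ord (leqnSn m) l = lift ord_max l.
Proof. exact/val_inj/esym/lift_max. Qed.

Lemma sum_append0 d (F : 'I_m.+1 -> 'I_n -> R -> R) : (forall i j, F i j 0 = 0) ->
  \sum_i \sum_j F i j (append0 d i j)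
    = \sum_l \sum_j F (widen_ord (leqnSn m) l) j (d l j).
Proof.
move=> F0; rewrite big_ord_recr/= [X in _ + X]big1 ?addr0 => [|j _].
  apply: eq_bigr => l _; apply: eq_bigr => j _.
  by rewrite mxE widen_lift_max liftK.
by rewrite mxE unlift_none F0.
Qed.

Lemma sum_prepend0 d (F : 'I_m.+1 -> 'I_n -> R -> R) : (forall i j, F i j 0 = 0) ->
  \sum_i \sum_j F i j (prepend0 d i j)
    = \sum_l \sum_j F (lift ord0 l) j (d l j).
Proof.
move=> F0; rewrite big_ord_recl/= [X in X + _]big1 ?add0r => [|j _].
  by apply: eq_bigr => l _; apply: eq_bigr => j _; rewrite mxE liftK.
by rewrite mxE unlift_none F0.
Qed.

Lemma dot_adjA d y : dot (adjA d) y = dot d (diffA y).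
Proof.
rewrite dotDl dotNl /dot.
rewrite (sum_append0 d (F := fun i j a => a * y i j)); last by move=> *; rewrite mul0r.
rewrite (sum_prepend0 d (F := fun i j a => a * y i j)); last by move=> *; rewrite mul0r.
rewrite -sumrB; apply: eq_bigr => l _; rewrite -sumrB; apply: eq_bigr => j _.
by rewrite mxE mulrBr.
Qed.

Lemma weighted_AMGM (p q a b : R) : 0 <= p -> 0 <= q ->
  (p = 0 -> b = 0) -> (q = 0 -> a = 0) ->
  `|a * b| * 2 <= p / q * a ^+ 2 + q / p * b ^+ 2.
Proof.
move=> p_ge0 q_ge0 pb qa.
have [p0|p_neq0] := eqVneq p 0.
  by rewrite p0 pb// mulr0 normr0 !mul0r expr0n mulr0 addr0.
have [q0|q_neq0] := eqVneq q 0.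
  by rewrite q0 qa// !mul0r normr0 expr0n mulr0 mul0r addr0.
have pq_gt0 : 0 < p * q by rewrite lt_neqAle eq_sym mulf_neq0// mulr_ge0.
rewrite -subr_ge0 normrM -(pmulr_rge0 _ pq_gt0).
rewrite -(real_normK (num_real a)) -(real_normK (num_real b)).
have -> : p * q * (p / q * `|a| ^+ 2 + q / p * `|b| ^+ 2 - `|a| * `|b| * 2)
  = (p * `|a| - q * `|b|) ^+ 2 by field; rewrite p_neq0 q_neq0.
exact: sqr_ge0.
Qed.

(* The weights [sin (i * theta)] are the Perron eigenvector of the path of
   length [m]: they vanish at both ends and satisfy the recurrence [s_rec]. *)
Lemma normr_dot_append0_prepend0 d :
  `|dot (append0 d) (prepend0 d)| <= cos (pi / m.+1%:R) * dot d d.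
Proof.
set theta : R := pi / m.+1%:R; pose s i : R := sin (i%:R * theta).
have s_gt0 i : (0 < i < m.+1)%N -> 0 < s i.
  case/andP=> i_gt0 i_lt; apply: sin_gt0_pi.
  rewrite mulr_gt0 ?ltr0n ?divr_gt0 ?pi_gt0 ?ltr0n//=.
  by rewrite mulrCA gtr_pMr ?pi_gt0// ltr_pdivrMr ?ltr0n// mul1r ltr_nat.
have s_ge0 i : (i <= m.+1)%N -> 0 <= s i.
  rewrite leq_eqVlt => /orP[/eqP->|i_lt].
    by rewrite /s /theta mulrCA divff ?pnatr_eq0// mulr1 sinpi.
  case: (posnP i) => [->|i_gt0]; first by rewrite /s mul0r sin0.
  by rewrite ltW// s_gt0// i_gt0.
have s_rec i : s i + s i.+2 = 2 * cos theta * s i.+1.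
  rewrite /s; have -> : i.+2%:R * theta = i.+1%:R * theta + theta.
    by rewrite [in LHS]mulrS; ring.
  have -> : i%:R * theta = i.+1%:R * theta - theta by rewrite [in RHS]mulrS; ring.
  by rewrite sinB sinD; ring.
rewrite -(ler_pM2r (ltr0Sn R 1)) [leRHS]mulrAC (mulrC (cos theta)).
have le_weighted : `|dot (append0 d) (prepend0 d)| * 2 <=
    \sum_(i < m.+1) \sum_(j < n) (s i / s i.+1 * append0 d i j ^+ 2
     + s i.+1 / s i * prepend0 d i j ^+ 2).
  apply: le_trans (ler_wpM2r _ (ler_norm_sum _ _ _)) _ => //.
  rewrite mulr_suml; apply: ler_sum => i _.
  apply: le_trans (ler_wpM2r _ (ler_norm_sum _ _ _)) _ => //.
  rewrite mulr_suml; apply: ler_sum => j _.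
  apply: weighted_AMGM; rewrite ?s_ge0 ?[(i <= _)%N]ltnW ?ltn_ord// ?mxE => si0.
    case: unliftP => // l il; have := s_gt0 i.
    by rewrite si0 ltxx {1}il ltn_ord => /(_ isT).
  case: unliftP => // l il; have := s_gt0 i.+1.
  by rewrite si0 ltxx il lift_max !ltnS ltn_ord => /(_ isT).
apply: le_trans le_weighted _.
under eq_bigr do rewrite big_split; rewrite big_split /=.
rewrite (sum_append0 d (F := fun i j a => s i / s i.+1 * a ^+ 2)); last first.
  by move=> *; rewrite expr0n mulr0.
rewrite (sum_prepend0 d (F := fun i j a => s i.+1 / s i * a ^+ 2)); last first.
  by move=> *; rewrite expr0n mulr0.
rewrite -big_split mulr_sumr; apply: ler_sum => l _.
rewrite -big_split mulr_sumr; apply: ler_sum => j _ /=.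
have s_neq0 : s l.+1 != 0 by rewrite gt_eqF// s_gt0// !ltnS ltn_ord.
by rewrite -mulrDl -mulrDl s_rec mulfK// expr2.
Qed.

Lemma dot_adjA_adjA d :
  dot (adjA d) (adjA d) = 2 * dot d d - 2 * dot (append0 d) (prepend0 d).
Proof.
rewrite /adjA !dotE (dotC (prepend0 d) (append0 d)).
have -> : dot (append0 d) (append0 d) = dot d d.
  rewrite {1}/dot (sum_append0 d (F := fun _ _ a => a * a))//.
  by move=> *; rewrite mul0r.
have -> : dot (prepend0 d) (prepend0 d) = dot d d.
  rewrite {1}/dot (sum_prepend0 d (F := fun _ _ a => a * a))//.
  by move=> *; rewrite mul0r.
by ring.
Qed.

Lemma adjA_ge d :
  (2 - 2 * cos (pi / m.+1%:R)) * dot d d <= dot (adjA d) (adjA d).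
Proof.
rewrite dot_adjA_adjA.
by have := normr_dot_append0_prepend0 d; rewrite ler_norml => /andP[_]; lra.
Qed.

Lemma adjA_le d :
  dot (adjA d) (adjA d) <= (2 + 2 * cos (pi / m.+1%:R)) * dot d d.
Proof.
rewrite dot_adjA_adjA.
by have := normr_dot_append0_prepend0 d; rewrite ler_norml => /andP[+ _]; lra.
Qed.

End Adjoint.

Lemma dot_gradient_step (R : realType) (m n : nat) (L : R) (v : 'M[R]_(m, n)) :
  0 < L -> dot v (- (L^-1 *: v)) + L / 2 * dot (- (L^-1 *: v)) (- (L^-1 *: v))
    = - (L^-1 / 2 * dot v v).
Proof. by move=> L_gt0; rewrite !dotE; field; rewrite gt_eqF. Qed.

Lemma dot_young (R : realType) (m n : nat) (c : R) (v w : 'M[R]_(m, n)) :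
  0 < c -> - (c^-1 / 2 * dot v v) <= c / 2 * dot w w + dot v w.
Proof.
move=> c_gt0; have := dot_ge0 (c *: w + v).
have -> : dot (c *: w + v) (c *: w + v)
    = 2 * c * (c / 2 * dot w w + dot v w + c^-1 / 2 * dot v v).
  by rewrite !dotE (dotC w v); field; rewrite gt_eqF.
by rewrite pmulr_rge0 ?mulr_gt0//; lra.
Qed.

Section Dual.
Variables (R : realType) (m n : nat) (f : 'I_m.+1 -> 'rV[R]_n.+1 -> R).
Implicit Types (lam d : 'M[R]_(m, n.+1)) (y z w : 'M[R]_(m.+1, n.+1)).

Let Y : set 'rV[R]_n.+1 := [set: 'rV[R]_n.+1].

Definition block_grad y : 'M[R]_(m.+1, n.+1) :=
  \matrix_(i, j) grad (f i) (row i y) ord0 j.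

Lemma row_block_grad y i : row i (block_grad y) = grad (f i) (row i y).
Proof. by apply/rowP => j; rewrite !mxE. Qed.

Lemma lagrangianE lam y :
  lagrangian f lam y = \sum_i f i (row i y) + dot (adjA lam) y.
Proof. by rewrite /lagrangian dot_adjA. Qed.

Lemma lagrangian_shift lam lam' y :
  lagrangian f lam' y = lagrangian f lam y + dot (lam' - lam) (diffA y).
Proof. by rewrite /lagrangian dotDl dotNl; ring. Qed.

Lemma dual_fun_argmin lam y : is_argmin (prod_set Y) (lagrangian f lam) y ->
  dual_fun Y f lam = (lagrangian f lam y)%:E.
Proof.
case=> Yy y_min; apply/eqP; rewrite eq_le; apply/andP; split.
  by apply: ereal_inf_lbound; exists y.
by apply/ereal_infP => _ [z Yz <-]; rewrite lee_fin y_min.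
Qed.

Section Smooth.
Variable L : 'I_m.+1 -> R.
Hypothesis f_diff : forall i x, differentiable (f i : 'rV[R]_n.+1 -> R^o) x.
Hypothesis L_gt0 : forall i, 0 < L i.
Hypothesis f_lip : forall i, lipschitz_grad (L i) (f i).

Lemma maxf_gt0 : 0 < maxf L.
Proof. exact: lt_le_trans (L_gt0 ord0) (le_bigmax _ _ _). Qed.

Lemma lagrangian_descent lam y w :
  lagrangian f lam (y + w) <= lagrangian f lam y
    + dot (block_grad y + adjA lam) w + maxf L / 2 * dot w w.
Proof.
rewrite !lagrangianE dotDl dotDr.
suff : \sum_i f i (row i (y + w)) <= \sum_i f i (row i y)
    + dot (block_grad y) w + maxf L / 2 * dot w w by lra.
rewrite [dot (block_grad y) w]dot_row [dot w w]dot_row mulr_sumr -!big_split.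
apply: ler_sum => i _; rewrite row_block_grad linearD/=.
apply: le_trans (descent_lemma _ _ (f_diff i) (f_lip i)) _.
by rewrite lerD2l ler_wpM2r ?dot_ge0// ler_wpM2r ?invr_ge0// le_bigmax.
Qed.

Lemma argmin_stationary lam y : is_argmin (prod_set Y) (lagrangian f lam) y ->
  block_grad y + adjA lam = 0.
Proof.
case=> _ y_min; set v := block_grad y + adjA lam.
have := y_min (y - (maxf L)^-1 *: v) (fun=> I).
move/le_trans/(_ (lagrangian_descent _ _ _)); 
rewrite -/v -addrA dot_gradient_step ?maxf_gt0// lerDl oppr_ge0.
by rewrite pmulr_rle0 ?divr_gt0 ?invr_gt0 ?maxf_gt0//; exact: dot_eq0.
Qed.

Lemma dual_fun_le lam y lam' : is_argmin (prod_set Y) (lagrangian f lam) y ->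
  (dual_fun Y f lam' <= (lagrangian f lam y + dot (lam' - lam) (diffA y)
    - (maxf L)^-1 / 2 * dot (adjA (lam' - lam)) (adjA (lam' - lam)))%:E)%E.
Proof.
move=> y_min; set d := lam' - lam; have L0 := maxf_gt0.
pose w := - ((maxf L)^-1 *: adjA d).
apply: (@le_trans _ _ (lagrangian f lam' (y + w))%:E).
  by apply: ereal_inf_lbound; exists (y + w).
rewrite lee_fin (lagrangian_shift lam lam') -/d -!dot_adjA dotDr.
have := lagrangian_descent lam y w; rewrite (argmin_stationary y_min).
rewrite -(scale0r 0) dotZl mul0r addr0; have := dot_gradient_step (adjA d) L0.
rewrite -/w; lra.
Qed.

End Smooth.

Section StronglyConvex.
Variable mu : 'I_m.+1 -> R.
Hypothesis mu_gt0 : forall i, 0 < mu i.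
Hypothesis f_sc : forall i, strongly_convex (mu i) (f i).

Lemma minf_gt0 : 0 < minf mu.
Proof. by apply: lt_bigmin => // i _. Qed.

Lemma strongly_convex_conv i (x1 x2 : 'rV[R]_n.+1) (t : R) : 0 <= t <= 1 ->
  f i (x1 + t *: (x2 - x1)) <= (1 - t) * f i x1 + t * f i x2
    - mu i / 2 * (t * (1 - t)) * dot (x2 - x1) (x2 - x1).
Proof.
move=> /andP[t_ge0 t_le1].
have : f i (t *: x2 + (1 - t) *: x1)
      - mu i / 2 * enorm (t *: x2 + (1 - t) *: x1) ^+ 2
    <= t * (f i x2 - mu i / 2 * enorm x2 ^+ 2)
      + (1 - t) * (f i x1 - mu i / 2 * enorm x1 ^+ 2).
  by apply: (f_sc i (Itv01 t_ge0 t_le1) (x := x2) (y := x1)); rewrite in_setT.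
rewrite !sqr_enorm.
have -> : t *: x2 + (1 - t) *: x1 = x1 + t *: (x2 - x1).
  by rewrite scalerBl scale1r scalerBr addrCA.
rewrite !dotE (dotC x2 x1); lra.
Qed.

Lemma lagrangian_growth lam y z : is_argmin (prod_set Y) (lagrangian f lam) y ->
  lagrangian f lam y + minf mu / 2 * dot (z - y) (z - y) <= lagrangian f lam z.
Proof.
case=> _ y_min; set q := minf mu / 2 * dot (z - y) (z - y).
have q_ge0 : 0 <= q by rewrite mulr_ge0 ?dot_ge0// divr_ge0// ltW// minf_gt0.
have growth t : 0 < t < 1 ->
    lagrangian f lam y + (1 - t) * q <= lagrangian f lam z.
  move=> /andP[t0 t1]; have := y_min (y + t *: (z - y)) (fun=> I).
  suff : lagrangian f lam (y + t *: (z - y)) <= (1 - t) * lagrangian f lam y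
      + t * lagrangian f lam z - t * (1 - t) * q.
    move=> /[swap] /le_trans /[apply] H.
    by rewrite -subr_ge0 -(pmulr_rge0 _ t0); lra.
  rewrite !lagrangianE dotDr dotZr dotDr dotNr.
  suff : \sum_i f i (row i (y + t *: (z - y))) <=
      (1 - t) * (\sum_i f i (row i y)) + t * (\sum_i f i (row i z))
      - t * (1 - t) * q by lra.
  rewrite /q [dot (z - y) _]dot_row !mulr_sumr -big_split -sumrB.
  apply: ler_sum => i _ /=; rewrite linearD linearZ linearB/=.
  apply: le_trans (strongly_convex_conv _ _ _ _) _; first by rewrite !ltW.
  rewrite lerD2l lerN2 [row i (z - y)]linearB [leLHS]mulrA.
  rewrite ler_wpM2r ?dot_ge0// [leRHS]mulrC.
  apply: ler_wpM2l; first by rewrite mulr_ge0 ?subr_ge0 ?ltW.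
  by rewrite ler_pM2r ?invr_gt0//; exact: bigmin_le.
rewrite leNgt; apply/negP => lt_z.
set g := lagrangian f lam y + q - lagrangian f lam z.
have g_gt0 : 0 < g by rewrite subr_gt0.
have t01 : 0 < g / (2 * (g + q)) < 1.
  by rewrite divr_gt0 ?ltr_pdivrMr/=; lra.
have := growth _ t01; rewrite leNgt => /negP; apply.
have : g / (2 * (g + q)) * q < g.
  rewrite mulrAC ltr_pdivrMr; last lra.
  by rewrite ltr_pM2l//; lra.
rewrite /g; lra.
Qed.

Lemma argmin_lagrangian_ge lam lam' y y' :
  is_argmin (prod_set Y) (lagrangian f lam) y ->
  lagrangian f lam y + dot (lam' - lam) (diffA y)
    - (minf mu)^-1 / 2 * dot (adjA (lam' - lam)) (adjA (lam' - lam))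
    <= lagrangian f lam' y'.
Proof.
move=> y_min; rewrite (lagrangian_shift lam lam').
apply: le_trans (lerD (lagrangian_growth y' y_min) (lexx _)).
rewrite -!dot_adjA; set a := adjA (lam' - lam).
have -> : y' = y + (y' - y) by rewrite addrC subrK.
set w := y' - y; rewrite [y + w - y]addrAC subrr add0r.
by have := dot_young a w minf_gt0; rewrite [dot a (y + w)]dotDr; lra.
Qed.

End StronglyConvex.

End Dual.

Lemma dot_diffA_le (R : realType) (m n : nat) (r : 'M[R]_(m.+1, n))
    (eps : 'I_m.+1 -> R) : (forall i, enorm (row i r) <= eps i) ->
  dot (diffA r) (diffA r) <= total_distortion eps ^+ 2.
Proof.
move=> r_le; rewrite sqr_sqrtr; last by apply: sumr_ge0 => l _; exact: sqr_ge0.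
rewrite dot_row; apply: ler_sum => l _; rewrite -sqr_enorm.
rewrite ler_pXn2r ?nnegrE ?enorm_ge0//; last first.
  by apply: addr_ge0; apply: le_trans (r_le _); exact: enorm_ge0.
have -> : row l (diffA r) = row (widen_ord (leqnSn m) l) r - row (lift ord0 l) r.
  by apply/rowP => j; rewrite !mxE.
by apply: le_trans (ler_enormB _ _) _; exact: lerD.
Qed.

(* There are m.+2 >= 2 agents, in dimension n.+1 >= 1. *)
Theorem lemma3 (R : realType) (m n : nat)
    (f : 'I_m.+2 -> 'rV[R]_n.+1 -> R) (mu L : 'I_m.+2 -> R)
    (mu_gt0 : forall i, 0 < mu i)
    (f_sc : forall i, strongly_convex (mu i) (f i))
    (f_diff : forall i x, differentiable (f i : 'rV[R]_n.+1 -> R^o) x)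
    (L_gt0 : forall i, 0 < L i)
    (f_lip : forall i, lipschitz_grad (L i) (f i))
    (lam_star : 'M[R]_(m.+1, n.+1))
    (lam_opt : dual_optimal [set: 'rV[R]_n.+1] f lam_star)
    (gamma : nat -> R) (lam : nat -> 'M[R]_(m.+1, n.+1))
    (y r : nat -> 'M[R]_(m.+2, n.+1)) (eps : 'I_m.+2 -> R)
    (algo : inexact_dual_algorithm [set: 'rV[R]_n.+1] f gamma lam y r)
    (r_le : forall k i, enorm (row i (r k)) <= eps i) :
  let Lh := (minf mu)^-1 * (2 + 2 * cos (pi / m.+2%:R)) in
  let muh := (maxf L)^-1 * (2 - 2 * cos (pi / m.+2%:R)) in
  let h := fun l => (- dual_fun [set: 'rV[R]_n.+1] f l)%E in
  (forall k, 0 < gamma k <= Lh^-1) ->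
  forall k : nat,
    (h (lam k.+1) - h lam_star <=
       (1 - gamma k * muh)%:E * (h (lam k) - h lam_star)
       + (gamma k * total_distortion eps ^+ 2 / 2)%:E)%E.
Proof.
move=> Lh muh h gamma_le k.
have [yk_min lam_step] := algo k; have [yk1_min _] := algo k.+1.
set g := gamma k in lam_step *; set c := cos (pi / m.+2%:R) in Lh muh gamma_le *.
have /andP[g_gt0 g_le] := gamma_le k; rewrite -/g in g_gt0 g_le.
have L_inv : 0 < (maxf L)^-1 by rewrite invr_gt0 maxf_gt0.
have mu_inv : 0 < (minf mu)^-1 by rewrite invr_gt0 minf_gt0.
have muh_ge0 : 0 <= muh.
  rewrite mulr_ge0 ?(ltW L_inv)//.
  by have := cos_le1 (pi / m.+2%:R : R); rewrite -/c; lra.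
have gLh_le1 : g * Lh <= 1.
  have Lh_ge0 : 0 <= Lh.
    rewrite mulr_ge0 ?(ltW mu_inv)//.
    by have := cos_geN1 (pi / m.+2%:R : R); rewrite -/c; lra.
  have [->|Lh_neq0] := eqVneq Lh 0; first by rewrite mulr0.
  by rewrite -ler_pdivlMr ?div1r// lt_neqAle eq_sym Lh_neq0.
have gk := dual_fun_argmin yk_min; have gk1 := dual_fun_argmin yk1_min.
have gs_le := dual_fun_le f_diff L_gt0 f_lip lam_star yk_min.
have gs_ge := lam_opt (lam k); rewrite gk in gs_ge.
have [gs gsE] : exists gs, dual_fun [set: 'rV[R]_n.+1] f lam_star = gs%:E.
  by case: (dual_fun _ f lam_star) gs_le gs_ge => // gs; exists gs.
rewrite gsE lee_fin in gs_le.
rewrite /h gsE gk gk1 -!EFinN -!EFinB -EFinM -EFinD lee_fin.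
set G := lagrangian f (lam k) (y k) in gs_le *.
set G1 := lagrangian f _ (y k.+1).
set a := diffA (y k) in gs_le *; set e := diffA (r k).
have diffAD : diffA (y k + r k) = a + e.
  by apply/matrixP => i j; rewrite !mxE; ring.
have step : G + g * dot a a / 2 - g * dot e e / 2 <= G1.
  have := argmin_lagrangian_ge mu_gt0 f_sc (lam k.+1) (y k.+1) yk_min.
  have -> : lam k.+1 - lam k = g *: (a + e).
    by rewrite lam_step [lam k + _]addrC addrK diffAD.
  rewrite -/a -/G -/G1.
  apply: le_trans.
  have : (minf mu)^-1 / 2 * dot (adjA (g *: (a + e))) (adjA (g *: (a + e)))
      <= g / 2 * dot (a + e) (a + e).
    apply: le_trans (ler_wpM2l _ (adjA_le _)) _; first by rewrite divr_ge0// ltW.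
    rewrite -/c dotZl dotZr.
    have -> : (minf mu)^-1 / 2 * ((2 + 2 * c) * (g * (g * dot (a + e) (a + e))))
      = g * Lh * (g / 2 * dot (a + e) (a + e)) by rewrite /Lh; ring.
    by rewrite ler_piMl// mulr_ge0 ?dot_ge0// divr_ge0// ltW.
  by rewrite !dotE (dotC e a); lra.
(* Polyak-Lojasiewicz inequality for [h]; multiplying by [muh] and completing
   the square avoids dividing by it. *)
have PL : muh * (gs - G) <= dot a a / 2.
  move: gs_le; move: (lam_star - lam k) => d gs_le.
  have : gs - G <= dot d a - muh / 2 * dot d d.
    have : muh / 2 * dot d d <= (maxf L)^-1 / 2 * dot (adjA d) (adjA d).
      have := adjA_ge d; rewrite -/c -(ler_pM2l L_inv) /muh; lra.
    lra.
  move/(ler_wpM2l muh_ge0)/le_trans; apply.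
  by have := dot_ge0 (muh *: d - a); rewrite !dotE (dotC a d); lra.
have := ler_wpM2l (ltW g_gt0) (dot_diffA_le (r_le k)); rewrite -/e.
have := ler_wpM2l (ltW g_gt0) PL.
move: (total_distortion eps ^+ 2) (dot e e) => te ee in step *.
by clearbody muh; lra.
Qed.
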